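(* Suppose $\tilde f:\mathbb{R}^{N\cdot M}\to\mathbb{R}$, $\tilde f(y)=\sum_{\alpha=1}^{M}\sum_{i=1}^{N} f_i^{[\alpha]}(y_i^{[\alpha]})$, is a twice continuously differentiable convex function. Then every trajectory $(y(t),\lambda(t))$, $t\ge 0$, of the multiplex saddle-point dynamics $$\dot y=-\nabla_y\tilde f(y)-\mathcal{L}y-\mathcal{L}\lambda,\qquad \dot\lambda=\mathcal{L}y,$$ with initial condition $(y(0),\lambda(0))=(y_0,\lambda_0)\in\mathbb{R}^{N\cdot M}\times\mathbb{R}^{N\cdot M}$, converges as $t\to\infty$ to a unique saddle point $(y^\star,\lambda^\star)$ of $\mathcal{L}_a(y,\lambda)=\tilde f(y)+\lambda^{T}\mathcal{L}y+\frac12 y^{T}\mathcal{L}y$, which is determined by the following conditions: 1. $y^\star=x^\star 1_{N\cdot M}$, where $x^\star\in\mathbb{R}$ is an optimizer of $\min_{x\in\mathbb{R}}\sum_{\alpha=1}^{M}\sum_{i=1}^{N}f_i^{[\alpha]}(x)$. 2. $\lambda^\star=\bar\lambda+\mathrm{average}(\lambda_0)\,1_{N\cdot M}$, where $\mathrm{average}(\lambda_0)$ is the arithmetic mean of the entries of the initial vector $\lambda_0=\lambda(0)$, and $\bar\lambda\perp 1_{N\cdot M}$ satisfies $\mathcal{L}\bar\lambda+\nabla_y\tilde f(y^\star)=0_{N\cdot M}$.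
   Context: Multiplex network: there are $N$ nodes $i\in V=\{1,\dots,N\}$ and $M$ layers $\alpha\in\mathcal{M}=\{1,\dots,M\}$; each pair $(i,\alpha)$ is a replica node. Within layer $\alpha$ there are symmetric nonnegative weights $w_{ij}^{[\alpha]}=w_{ji}^{[\alpha]}\ge 0$ (undirected intralinks) and an intralayer diffusion constant $D^{[\alpha]}>0$; between layers $\alpha\ne\beta$, each replica node $(i,\alpha)$ is linked to $(i,\beta)$ with interlayer diffusion constant $D^{[\alpha,\beta]}=D^{[\beta,\alpha]}\ge 0$. The vector $y\in\mathbb{R}^{N\cdot M}$ has entries $y_i^{[\alpha]}$ (stacked layer by layer). The supra-Laplacian $\mathcal{L}\in\mathbb{R}^{N\cdot M\times N\cdot M}$ is the symmetric matrix defined by $$(\mathcal{L}y)_i^{[\alpha]}=D^{[\alpha]}\sum_{j=1}^N w_{ij}^{[\alpha]}\,(y_i^{[\alpha]}-y_j^{[\alpha]})+\sum_{\beta\neq\alpha}D^{[\alpha,\beta]}\,(y_i^{[\alpha]}-y_i^{[\beta]}).$$ The multiplex network is assumed connected including interlinks: the graph on the $N\cdot M$ replica nodes whose edges are the links with positive coefficient ($D^{[\alpha]}w_{ij}^{[\alpha]}>0$ or $D^{[\alpha,\beta]}>0$) is connected. Standing assumptions on the costs: each $f_i^{[\alpha]}:\mathbb{R}\to\mathbb{R}$ is convex and differentiable with Lipschitz continuous derivative, and the problem $\min_{x\in\mathbb{R}}\sum_{\alpha=1}^{M}\sum_{i=1}^{N}f_i^{[\alpha]}(x)$ has a unique optimal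 solution $x^\star$. $1_{N\cdot M}$ and $0_{N\cdot M}$ are the all-ones and all-zeros vectors in $\mathbb{R}^{N\cdot M}$. A saddle point of $\mathcal{L}_a$ is a pair $(y^\star,\lambda^\star)$ with $\mathcal{L}_a(y^\star,\lambda)\le\mathcal{L}_a(y^\star,\lambda^\star)\le\mathcal{L}_a(y,\lambda^\star)$ for all $y,\lambda\in\mathbb{R}^{N\cdot M}$. *)

(* Defs.v *)
From HB Require Import structures.
From mathcomp Require Import all_boot all_order all_algebra.
From mathcomp Require Import all_classical all_reals all_analysis.
From mathcomp Require Import ring.

Set Implicit Arguments.
Unset Strict Implicit.
Unset Printing Implicit Defensive.

Import Order.TTheory GRing.Theory Num.Theory.
Import numFieldNormedType.Exports.

Local Open Scope classical_set_scope.
Local Open Scope ring_scope.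

(* The diagonal coefficients [interdiff a a] are irrelevant: only pairs of
   distinct layers are ever used. *)
Record multiplex (R : realType) (M N : nat) := Multiplex {
  weight : 'I_M -> 'I_N -> 'I_N -> R;
  intradiff : 'I_M -> R;
  interdiff : 'I_M -> 'I_M -> R;
  weight_ge0 : forall a i j, 0 <= weight a i j;
  weight_sym : forall a i j, weight a i j = weight a j i;
  intradiff_gt0 : forall a, 0 < intradiff a;
  interdiff_ge0 : forall a b, a != b -> 0 <= interdiff a b;
  interdiff_sym : forall a b, interdiff a b = interdiff b a
}.

Section Multiplex.
Context {R : realType} {M N : nat}.
Implicit Type G : multiplex R M N.

(* Replica node (a, i) has position [mxvec_index a i] = a * N + i in the stacked
   vector, i.e. vectors are stacked layer by layer. *)
Definition entry (y : 'cV[R]_(M * N)) (a : 'I_M) (i : 'I_N) : R :=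
  y (mxvec_index a i) 0.

Definition stack (Y : 'M[R]_(M, N)) : 'cV[R]_(M * N) := (mxvec Y)^T.

Lemma stackE Y a i : entry (stack Y) a i = Y a i.
Proof. by rewrite /entry mxE mxvecE. Qed.

Definition supra_diffusion G (y : 'cV[R]_(M * N)) : 'cV[R]_(M * N) :=
  stack (\matrix_(a, i)
    (intradiff G a * (\sum_j weight G a i j * (entry y a i - entry y a j)) +
     \sum_(b | b != a) interdiff G a b * (entry y a i - entry y b i))).

(* The matrix of the linear map [supra_diffusion G]; see [supra_laplacianE]. *)
Definition supra_laplacian G : 'M[R]_(M * N) :=
  \matrix_(p, q) supra_diffusion G (delta_mx q 0) p 0.

Lemma supra_diffusion_linear G (c : R) (y z : 'cV[R]_(M * N)) :
  supra_diffusion G (c *: y + z) =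
  c *: supra_diffusion G y + supra_diffusion G z.
Proof.
apply/colP => p; case/mxvec_indexP: p => a i.
rewrite !mxE !mxvecE !mxE mulrDr addrACA !mulr_sumr -!big_split /=.
by congr (_ + _); apply: eq_bigr => k _; rewrite /entry !mxE; ring.
Qed.

Lemma supra_laplacianE G (y : 'cV[R]_(M * N)) :
  supra_laplacian G *m y = supra_diffusion G y.
Proof.
have diff0 : supra_diffusion G 0 = 0.
  have := supra_diffusion_linear G (-1) 0 0.
  by rewrite scaler0 addr0 scaleN1r addNr.
have diffD : {morph supra_diffusion G : u v / u + v}.
  by move=> u v; rewrite -[u in LHS]scale1r supra_diffusion_linear scale1r.
have -> : y = \sum_q y q 0 *: delta_mx q 0.
  by rewrite {1}[y]matrix_sum_delta; apply: eq_bigr => q _; rewrite big_ord1.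
rewrite mulmx_sumr (big_morph _ diffD diff0); apply: eq_bigr => q _.
rewrite -[_ *: _]addr0 supra_diffusion_linear diff0 !addr0 -scalemxAr -colE.
by congr (_ *: _); apply/colP => p; rewrite !mxE.
Qed.

(* Edges of the graph on the replica nodes, as (layer, node) pairs. *)
Definition replica_adj G : rel ('I_M * 'I_N) := fun p q =>
  ((p.1 == q.1) && (0 < intradiff G p.1 * weight G p.1 p.2 q.2)) ||
  [&& p.2 == q.2, p.1 != q.1 & 0 < interdiff G p.1 q.1].

Definition multiplex_connected G : Prop :=
  forall p q, connect (replica_adj G) p q.

Implicit Type f : 'I_M -> 'I_N -> R -> R.

Definition common_cost f (x : R) : R := \sum_a \sum_i f a i x.

Definition ftilde f (y : 'cV[R]_(M * N)) : R := \sum_a \sum_i f a i (entry y a i).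

End Multiplex.

Definition minimizer {R : realType} {T : Type} (F : T -> R) (x : T) : Prop :=
  forall z, F x <= F z.

Section VectorCalculus.
Context {R : realType} {n : nat}.
Implicit Types (F : 'cV[R]_n -> R) (u v y : 'cV[R]_n).

Definition partial F (k : 'I_n) : 'cV[R]_n -> R := 'D_(delta_mx k 0) F.

Definition gradient F y : 'cV[R]_n := \col_k partial F k y.

(* [partial] is a junk value where the derivative does not exist, hence the
   explicit derivability requirements. *)
Definition twice_continuously_differentiable F : Prop :=
  [/\ forall k y, derivable F y (delta_mx k 0),
      forall k, continuous (partial F k),
      forall k l y, derivable (partial F k) y (delta_mx l 0)
    & forall k l, continuous (partial (partial F k) l)].

Definition dot u v : R := (u^T *m v) 0 0.

Definition average u : R := (\sum_k u k 0) / n%:R.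

Definition saddle_point (La : 'cV[R]_n -> 'cV[R]_n -> R) (ys ls : 'cV[R]_n) :
  Prop := forall y l, La ys l <= La ys ls /\ La ys ls <= La y ls.

End VectorCalculus.

Section SaddleDynamics.
Context {R : realType} {M N : nat}.
Implicit Types (G : multiplex R M N) (f : 'I_M -> 'I_N -> R -> R).

Definition augmented_lagrangian G f (y l : 'cV[R]_(M * N)) : R :=
  ftilde f y + dot l (supra_laplacian G *m y)
  + 2^-1 * dot y (supra_laplacian G *m y).

(* Only the values of [y] and [l] on [0, +oo[ matter.  The equations are imposed
   for t > 0 and the initial condition is attained continuously; for a
   continuous vector field this is the same as also imposing the equations with
   a right derivative at t = 0. *)
Definition saddle_point_trajectory G f (y0 l0 : 'cV[R]_(M * N))
    (y l : R -> 'cV[R]_(M * N)) : Prop :=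
  let L := supra_laplacian G in
  [/\ y 0 = y0 /\ l 0 = l0,
      {within `[0, +oo[, continuous y},
      {within `[0, +oo[, continuous l},
      forall t : R, 0 < t ->
        is_derive t 1 y (- gradient (ftilde f) (y t) - L *m y t - L *m l t)
    & forall t : R, 0 < t -> is_derive t 1 l (L *m y t)].

Definition limit_conditions G f (l0 ys ls : 'cV[R]_(M * N)) : Prop :=
  (exists2 x : R, minimizer (common_cost f) x & ys = x *: const_mx 1) /\
  (exists lbar : 'cV[R]_(M * N),
    [/\ dot lbar (const_mx 1) = 0,
        supra_laplacian G *m lbar + gradient (ftilde f) ys = 0
      & ls = lbar + average l0 *: const_mx 1]).

End SaddleDynamics.

(* Main.v *)
Require Import Defs.
From HB Require Import structures.
From mathcomp Require Import all_boot all_order all_algebra.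
From mathcomp Require Import all_classical all_reals all_analysis.
From mathcomp Require Import ring lra.

Set Implicit Arguments.
Unset Strict Implicit.
Unset Printing Implicit Defensive.

Import Order.TTheory GRing.Theory Num.Theory.
Import numFieldNormedType.Exports.

Local Open Scope classical_set_scope.
Local Open Scope ring_scope.

(** The proof is a Lyapunov argument completed by Barbalat's lemma.

    Write [h k] for the derivative of the cost of node [k].  The supra-Laplacian
    is the Laplacian of a connected weighted graph, so it is positive
    semidefinite and its kernel consists of the constant vectors.  The optimizer
    [x] is the only zero of [\sum_k h k], hence the vector of the [h k x] is
    orthogonal to the constants and lies in the range of the Laplacian
    ([laplacian_solve]).  This gives [ys] and [ls], unique once the average of
    [ls] is prescribed; that they form a saddle point is the tangent inequality
    for convex functions ([convex_tangent]).

    Along a trajectory put [mu = l - ls].  The derivative of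
    [\sum_k (y k - x)^2 + (mu k)^2] is [-2] times the sum of two nonnegative
    terms, [\sum_k (h k (y k) - h k x) * (y k - x)] and the energy of [y]
    ([lyapunov_derive]).  So the trajectory is bounded, therefore Lipschitz, and
    Barbalat's lemma ([barbalat]) makes both terms tend to zero.
    Vanishing energy forces the entries of [y] to a common value
    ([energy_cvg0]), and then the first term forces that value to tend to the
    only zero [x] of the monotone function [\sum_k h k] ([y_cvg]).  Barbalat's
    lemma applied to [y] itself gives [y' --> 0], so that the Laplacian of [mu]
    tends to zero ([laplacian_mu_cvg0]).  The differences between entries of
    [mu] thus vanish in the limit, and as the sum of the entries of [l] is
    conserved, the entries of [mu] sum to zero and each of them tends to zero
    ([l_cvg]). *)

(** * Functions on a half-line *)

Section HalfLine.
Context {R : realType}.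
Implicit Types (u v h du : R -> R).

Lemma mean_value u du (s t : R) :
  (forall r : R, s <= r -> r <= t -> is_derive r 1 u (du r)) -> s < t ->
  exists2 c, s < c < t & u t - u s = du c * (t - s).
Proof.
move=> u' st.
have [||c + E] := @MVT R u du s t st.
- by move=> r; rewrite in_itv /= => /andP[/ltW sr /ltW rt]; exact: u'.
- apply: derivable_within_continuous => r; rewrite in_itv /= => /andP[sr rt].
  by have [] := u' r sr rt.
by rewrite in_itv /=; exists c.
Qed.

(** The dynamics is only known for positive times, so that estimates start at a
    fixed positive time, here 1. *)
Definition bounded_tail u := exists K, forall t, 1 <= t -> `|u t| <= K.

Definition lipschitz_tail u := exists K,
  forall s t, 1 <= s -> 1 <= t -> `|u s - u t| <= K * `|s - t|.

Definition tame u := bounded_tail u /\ lipschitz_tail u.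

Lemma bounded_tail_cst (a : R) : bounded_tail (fun=> a).
Proof. by exists `|a|. Qed.

Lemma bounded_tailD u v : bounded_tail u -> bounded_tail v ->
  bounded_tail (fun t => u t + v t).
Proof.
move=> [K hK] [K' hK']; exists (K + K') => t t1.
by rewrite (le_trans (ler_normD _ _))// lerD ?hK ?hK'.
Qed.

Lemma bounded_tailM u v : bounded_tail u -> bounded_tail v ->
  bounded_tail (fun t => u t * v t).
Proof.
move=> [K hK] [K' hK']; exists (K * K') => t t1.
by rewrite normrM ler_pM ?hK ?hK'.
Qed.

Lemma bounded_tailN u : bounded_tail u -> bounded_tail (fun t => - u t).
Proof. by move=> [K hK]; exists K => t /hK; rewrite normrN. Qed.

Lemma bounded_tailB u v : bounded_tail u -> bounded_tail v ->
  bounded_tail (fun t => u t - v t).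
Proof. by move=> bu /bounded_tailN; exact: bounded_tailD. Qed.

Lemma bounded_tail_comp h u (K : R) : (forall a b, `|h a - h b| <= K * `|a - b|) ->
  bounded_tail u -> bounded_tail (fun t => h (u t)).
Proof.
move=> hK [K' uK']; exists (`|h 0| + `|K| * K') => t t1.
rewrite -[h (u t)](subrKC (h 0)) (le_trans (ler_normD _ _))// lerD2l.
rewrite (le_trans (hK _ _))// subr0 (le_trans (ler_norm _))// normrM normr_id.
by rewrite ler_wpM2l ?uK'.
Qed.

Lemma tame_cst (a : R) : tame (fun=> a).
Proof.
by split; [exact: bounded_tail_cst|exists 0 => s t _ _; rewrite subrr normr0 mul0r].
Qed.

Lemma tameD u v : tame u -> tame v -> tame (fun t => u t + v t).
Proof.
move=> [bu [K hK]] [bv [K' hK']]; split; first exact: bounded_tailD.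
exists (K + K') => s t s1 t1; rewrite opprD addrACA mulrDl.
by rewrite (le_trans (ler_normD _ _))// lerD ?hK ?hK'.
Qed.

Lemma tameM u v : tame u -> tame v -> tame (fun t => u t * v t).
Proof.
move=> [bu [K hK]] [bv [K' hK']]; split; first exact: bounded_tailM.
have [B hB] := bu; have [B' hB'] := bv.
exists (B * K' + B' * K) => s t s1 t1.
have -> : u s * v s - u t * v t = u s * (v s - v t) + v t * (u s - u t) by ring.
rewrite (le_trans (ler_normD _ _))// mulrDl -!mulrA !normrM.
by rewrite lerD// ler_pM ?hB ?hB' ?hK ?hK'.
Qed.

Lemma tameN u : tame u -> tame (fun t => - u t).
Proof.
move=> [bu [K hK]]; split; first exact: bounded_tailN.
by exists K => s t s1 t1; rewrite -opprD normrN hK.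
Qed.

Lemma tameB u v : tame u -> tame v -> tame (fun t => u t - v t).
Proof. by move=> tu /tameN; exact: tameD. Qed.

Lemma tame_comp h u (K : R) : (forall a b, `|h a - h b| <= K * `|a - b|) ->
  tame u -> tame (fun t => h (u t)).
Proof.
move=> hK [bu [K' uK']]; split; first exact: bounded_tail_comp hK bu.
exists (`|K| * K') => s t s1 t1.
rewrite (le_trans (hK _ _))// (le_trans (ler_norm _))// normrM normr_id.
by rewrite -mulrA ler_wpM2l ?uK'.
Qed.

Lemma bounded_tail_sum (T : finType) (u : T -> R -> R) :
  (forall k, bounded_tail (u k)) -> bounded_tail (fun t => \sum_k u k t).
Proof.
move=> bu; suff : bounded_tail (fun t => (\sum_k u k) t).
  by under eq_fun do rewrite fct_sumE.
by elim/big_ind: _ => // [|v w]; [exact: bounded_tail_cst|exact: bounded_tailD].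
Qed.

Lemma tame_sum (T : finType) (u : T -> R -> R) :
  (forall k, tame (u k)) -> tame (fun t => \sum_k u k t).
Proof.
move=> bu; suff : tame (fun t => (\sum_k u k) t).
  by under eq_fun do rewrite fct_sumE.
by elim/big_ind: _ => // [|v w]; [exact: tame_cst|exact: tameD].
Qed.

Lemma is_derive_fin_sum (T : finType) (u du : T -> R -> R) (t : R) :
  (forall k, is_derive t 1 (u k) (du k t)) ->
  is_derive t 1 (fun s => \sum_k u k s) (\sum_k du k t).
Proof.
move=> u'; rewrite (_ : (fun s => _) = \sum_k u k); last first.
  by apply/funext => s; rewrite fct_sumE.
by elim/big_ind2 : _ => // *; [exact: is_derive_cst|exact: is_deriveD].
Qed.

Lemma tame_derive u du : (forall t : R, 1 <= t -> is_derive t 1 u (du t)) ->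
  bounded_tail u -> bounded_tail du -> tame u.
Proof.
move=> u' bu [K hK]; split => //; exists K.
have lip s t : 1 <= s -> s < t -> `|u s - u t| <= K * `|s - t|.
  move=> s1 st; have [|c /andP[sc _] E] := @mean_value u du s t _ st.
    by move=> r sr _; apply: u'; exact: le_trans sr.
  rewrite distrC E normrM [`|s - t|]distrC ler_wpM2r// hK//.
  by rewrite (le_trans s1)// ltW.
move=> s t s1 t1; have [st|ts|->] := ltgtP s t; first exact: lip.
  by rewrite distrC [`|s - t|]distrC; exact: lip.
by rewrite !subrr normr0 mulr0.
Qed.

Lemma cvg_tailP u (l : R) : u t @[t --> +oo] --> l <->
  forall e, 0 < e -> exists A, forall t, A <= t -> `|u t - l| <= e.
Proof.
split=> [/cvgrPdist_le ul e e0|ul].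
  have [A [_ hA]] := ul _ e0; exists (A + 1) => t At; rewrite distrC; apply: hA.
  by rewrite (lt_le_trans _ At)// ltrDl.
apply/cvgrPdist_le => e /ul[A hA]; exists A; split; first exact: num_real.
by move=> t /ltW/hA; rewrite distrC.
Qed.

Lemma squeeze_tail u v (C : R) : v t @[t --> +oo] --> 0 ->
  (forall t, 1 <= t -> `|u t| <= C * `|v t|) -> u t @[t --> +oo] --> 0.
Proof.
move=> /cvg_tailP v0 uv; apply/cvg_tailP => e e0.
have C0 : 0 < `|C| + 1 by rewrite ltr_wpDl.
have [|A hA] := v0 (e / (`|C| + 1)); first by rewrite divr_gt0.
exists (Num.max 1 A) => t; rewrite ge_max => /andP[t1 /hA].
rewrite !subr0 ler_pdivlMr// => vt; rewrite (le_trans (uv _ t1))//.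
by rewrite (le_trans _ vt)// mulrC ler_wpM2l// ler_wpDr// ler_norm.
Qed.

Lemma bounded_tail_cvg0M u v : bounded_tail u -> v t @[t --> +oo] --> 0 ->
  u t * v t @[t --> +oo] --> 0.
Proof.
move=> [K hK] v0; apply: (squeeze_tail (C := K) v0) => t t1.
by rewrite normrM ler_wpM2r ?hK.
Qed.

Lemma cvg0_sqr u : u t ^+ 2 @[t --> +oo] --> 0 -> u t @[t --> +oo] --> 0.
Proof.
move=> /cvg_tailP u0; apply/cvg_tailP => e e0.
have [|A hA] := u0 (e ^+ 2); first by rewrite exprn_gt0.
exists A => t /hA; rewrite !subr0 normrX ler_pXn2r// ?nnegrE//.
by rewrite ltW.
Qed.

Lemma nonincreasing_tail_cvg u : (forall t, 1 <= t -> 0 <= u t) ->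
  (forall s t, 1 <= s -> s <= t -> u t <= u s) ->
  exists l : R, u t @[t --> +oo] --> l.
Proof.
move=> u0 ud; pose w t := - u (Num.max 1 t).
have wc : w t @[t --> +oo] --> sup (range w).
  apply: nondecreasing_cvgr.
    move=> s t st; rewrite lerN2; apply: ud; first by rewrite le_max lexx.
    by rewrite ge_max le_max lexx /= le_max st orbT.
  by exists 0 => _ [t _ <-]; rewrite oppr_le0 u0// le_max lexx.
exists (- sup (range w)); apply/cvg_tailP => e e0.
have [A hA] := (cvg_tailP _ _).1 wc e e0.
exists (Num.max 1 A) => t; rewrite ge_max => /andP[t1 At].
have -> : u t - - sup (range w) = - (w t - sup (range w)).
  by rewrite /w max_r// opprB !opprK addrC.
by rewrite normrN hA.
Qed.

(** Barbalat's lemma.  Over a window of fixed length the increment of [u] is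
    eventually small, so by the mean value theorem [du] is small somewhere in the
    window; the Lipschitz bound carries this to the left end of the window. *)
Lemma barbalat u du (l : R) : (forall t : R, 1 <= t -> is_derive t 1 u (du t)) ->
  lipschitz_tail du -> u t @[t --> +oo] --> l -> du t @[t --> +oo] --> 0.
Proof.
move=> u' [K0 hK0] /cvg_tailP ul; apply/cvg_tailP => e e0.
set K := `|K0| + 1; have K0lt : 0 < K by rewrite ltr_wpDl.
have hK s t : 1 <= s -> 1 <= t -> `|du s - du t| <= K * `|s - t|.
  move=> s1 t1; rewrite (le_trans (hK0 _ _ s1 t1))// ler_wpM2r//.
  by rewrite ler_wpDr// ler_norm.
(* [K * d = e / 2], the most that [du] can vary over the window *)
set d := e / (2 * K); have d0 : 0 < d by rewrite divr_gt0// mulr_gt0.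
have [|A hA] := ul (d * (e / 4)); first by rewrite mulr_gt0// divr_gt0.
exists (Num.max 1 A) => t; rewrite ge_max subr0 => /andP[t1 At].
have [||c /andP[tc ctd] E] := @mean_value u du t (t + d).
- by move=> r tr _; apply: u'; exact: le_trans tr.
- by rewrite ltrDl.
have Atd : A <= t + d by rewrite (le_trans At)// lerDl ltW.
have duc : `|du c| <= e / 2.
  have : `|u (t + d) - u t| <= d * (e / 2).
    rewrite -(subrKA l) (le_trans (ler_normD _ _))// [`|l - _|]distrC.
    have -> : d * (e / 2) = d * (e / 4) + d * (e / 4) by field.
    by rewrite lerD// hA.
  by rewrite E addrAC subrr add0r normrM [`|d|]gtr0_norm// mulrC ler_pM2l.
have c1 : 1 <= c by rewrite (le_trans t1)// ltW.
have dut : `|du t - du c| <= e / 2.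
  rewrite (le_trans (hK _ _ t1 c1))// distrC gtr0_norm ?subr_gt0//.
  have -> : e / 2 = K * d by rewrite /d; field; rewrite gt_eqF.
  by rewrite ler_pM2l// lerBlDl ltW.
by rewrite -(subrK (du c) (du t)) (le_trans (ler_normD _ _))// (splitr e) lerD.
Qed.

End HalfLine.

(** * Laplacians of weighted graphs *)

Section Laplacian.
Context {R : realType} {T : finType}.
Implicit Types (c : T -> T -> R) (u v : T -> R).

Definition laplacian c u (p : T) : R := \sum_q c p q * (u p - u q).

Lemma laplacian_cst c (a : R) p : laplacian c (fun=> a) p = 0.
Proof. by rewrite /laplacian big1// => q _; rewrite subrr mulr0. Qed.

Lemma laplacianB c u v p :
  laplacian c (fun q => u q - v q) p = laplacian c u p - laplacian c v p.
Proof. by rewrite /laplacian -sumrB; apply: eq_bigr => q _; ring. Qed.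

Context (c : T -> T -> R) (c_sym : forall p q, c p q = c q p).

(** Summation by parts: average the left-hand side with the same sum in which the
    two ends of every edge are exchanged. *)
Lemma laplacian_green u v :
  \sum_p v p * laplacian c u p =
  2^-1 * \sum_p \sum_q c p q * ((v p - v q) * (u p - u q)).
Proof.
have E : \sum_p v p * laplacian c u p =
    \sum_p \sum_q c p q * (v p * (u p - u q)).
  by apply: eq_bigr => p _; rewrite mulr_sumr; apply: eq_bigr => q _; ring.
have E' : \sum_p v p * laplacian c u p =
    \sum_p \sum_q c p q * (- v q * (u p - u q)).
  rewrite E exchange_big; apply: eq_bigr => p _; apply: eq_bigr => q _.
  by rewrite c_sym; ring.
apply: (mulfI (x := 2)) => //; rewrite mulrA divff// mul1r mulrDl !mul1r.
rewrite {1}E E' -big_split; apply: eq_bigr => p _ /=.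
by rewrite -big_split; apply: eq_bigr => q _ /=; ring.
Qed.

Lemma laplacian_sym u v :
  \sum_p v p * laplacian c u p = \sum_p u p * laplacian c v p.
Proof.
rewrite !laplacian_green; congr (_ * _); apply: eq_bigr => p _.
by apply: eq_bigr => q _; rewrite [(v p - _) * _]mulrC.
Qed.

Lemma sum_laplacian u : \sum_p laplacian c u p = 0.
Proof.
under eq_bigr do rewrite -[laplacian _ _ _]mul1r.
rewrite (laplacian_sym u (fun=> 1)) big1// => p _.
by rewrite laplacian_cst mulr0.
Qed.

Definition energy u : R := \sum_p u p * laplacian c u p.

Context (c_ge0 : forall p q, 0 <= c p q).

Lemma energy_ge0 u : 0 <= energy u.
Proof.
rewrite /energy laplacian_green mulr_ge0 ?invr_ge0//.
by do 2![apply: sumr_ge0 => ? _]; rewrite mulr_ge0// -expr2 sqr_ge0.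
Qed.

Lemma edge_le_energy u p q : c p q * (u p - u q) ^+ 2 <= 2 * energy u.
Proof.
rewrite /energy laplacian_green mulVKf//.
rewrite (bigD1 p)//= (bigD1 q)//= -addrA -expr2 lerDl addr_ge0//.
  by apply: sumr_ge0 => ? _; rewrite mulr_ge0// -expr2 sqr_ge0.
by do 2![apply: sumr_ge0 => ? _]; rewrite mulr_ge0// -expr2 sqr_ge0.
Qed.

Context (c_connected : forall p q, connect (fun r s => 0 < c r s) p q).

(** Vanishing energy forces consensus: the energy controls the difference along
    every edge, and a path of edges joins any two nodes. *)
Lemma energy_cvg0 (u : T -> R -> R) :
  energy (u ^~ t) @[t --> +oo] --> 0 ->
  forall p q, u p t - u q t @[t --> +oo] --> 0.
Proof.
move=> en0 p q; have [w + ->] := connectP (c_connected p q).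
elim: w p => [p _|r w IH p /= /andP[cpr /IH]] /=.
  by under eq_fun do rewrite subrr; exact: cvg_cst.
move: (last r w) => s rs0.
suff pr0 : u p t - u r t @[t --> +oo] --> 0.
  have -> : (fun t => u p t - u s t) =
      (fun t => u p t - u r t) + (fun t => u r t - u s t).
    by apply/funext => t; rewrite fctE subrKA.
  have := cvgD pr0 rs0; rewrite addr0.
  exact.
apply: cvg0_sqr.
apply: (squeeze_tail (C := 2 / c p r) en0) => t _.
rewrite ger0_norm ?sqr_ge0// ger0_norm ?energy_ge0// mulrAC ler_pdivlMr// mulrC.
exact: (edge_le_energy (u ^~ t)).
Qed.

Lemma energy_eq0 u : energy u = 0 -> forall p q, u p = u q.
Proof.
move=> en0 p q; have := @energy_cvg0 (fun p _ => u p).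
rewrite en0 => /(_ (cvg_cst _) p q)/cvg_lim; rewrite lim_cst//.
by move=> /(_ (@norm_hausdorff _ _))/eqP; rewrite subr_eq0 => /eqP.
Qed.

Lemma laplacian_eq0 u : (forall p, laplacian c u p = 0) -> forall p q, u p = u q.
Proof.
by move=> lap0; apply: energy_eq0; rewrite /energy big1// => p _; rewrite lap0 mulr0.
Qed.

End Laplacian.

(** Adding the all-ones matrix to the Laplacian removes its kernel.  The solution
    of the modified system has zero sum, because the right-hand side and the image
    of the Laplacian do, and hence solves the original system. *)
Lemma laplacian_solve {R : realType} {n : nat} (c : 'I_n -> 'I_n -> R)
    (c_sym : forall p q, c p q = c q p) (c_ge0 : forall p q, 0 <= c p q)
    (c_connected : forall p q, connect (fun r s => 0 < c r s) p q)
    (b : 'I_n -> R) : \sum_p b p = 0 ->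
  exists2 u : 'I_n -> R, \sum_p u p = 0 & forall p, laplacian c u p = b p.
Proof.
move=> sumb.
pose A := \matrix_(p, q) ((p == q)%:R * (\sum_r c p r) - c p q + 1) : 'M[R]_n.
have AE (u : 'cV[R]_n) p : (A *m u) p 0 = laplacian c (fun q => u q 0) p + \sum_q u q 0.
  rewrite mxE /laplacian -big_split /=.
  under eq_bigr do rewrite mxE mulrDl mul1r mulrBl.
  rewrite big_split sumrB /= big_split /=; congr (_ + _).
  under [in RHS]eq_bigr do rewrite mulrBr.
  rewrite sumrB -mulr_suml; congr (_ - _); set d := \sum_r c p r.
  rewrite (bigD1 p)//= big1 ?addr0 => [|q qp]; first by rewrite eqxx mul1r.
  by rewrite eq_sym (negbTE qp) !mul0r.
have sumA (u : 'cV[R]_n) : \sum_p (A *m u) p 0 = n%:R * \sum_q u q 0.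
  under eq_bigr do rewrite AE.
  by rewrite big_split /= sum_laplacian// add0r sumr_const card_ord mulr_natl.
have n0 (u : 'cV[R]_n) : n%:R * \sum_q u q 0 = 0 -> \sum_q u q 0 = 0.
  move=> /eqP; rewrite mulf_eq0 pnatr_eq0 => /orP[/eqP n_0|/eqP//].
  by rewrite big1// => q _; have := ltn_ord q; rewrite {2}n_0.
have Aunit : A^T \in unitmx.
  rewrite unitmxE unitfE; apply/det0P => -[v v0 vA].
  have Av p : (A *m v^T) p 0 = 0 by rewrite -[A]trmxK -trmx_mul vA !mxE.
  have sv : \sum_q v^T q 0 = 0.
    by apply: n0; rewrite -sumA big1// => p _; rewrite Av.
  have cst : forall p q, v^T p 0 = v^T q 0.
    apply: (laplacian_eq0 c_sym c_ge0 c_connected (u := fun p => v^T p 0)) => p.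
    by have := AE v^T p; rewrite Av sv addr0 => <-.
  move/negP: v0; apply; apply/eqP/rowP => p; rewrite mxE.
  have : n%:R * v^T p 0 = 0.
    rewrite -sv (eq_bigr (fun=> v^T p 0)); last by move=> q _; exact: cst.
    by rewrite sumr_const card_ord mulr_natl.
  move/eqP; rewrite mulf_eq0 pnatr_eq0 mxE => /orP[/eqP n_0|/eqP//].
  by have := ltn_ord p; rewrite {2}n_0.
rewrite unitmx_tr in Aunit.
pose u := invmx A *m \col_p b p.
have Au p : (A *m u) p 0 = b p by rewrite mulKVmx// mxE.
have su : \sum_q u q 0 = 0.
  by apply: n0; rewrite -sumA -[RHS]sumb; apply: eq_bigr => p _.
by exists (fun p => u p 0) => // p; have := AE u p; rewrite Au su addr0.
Qed.

(** * Saddle-point dynamics on a weighted graph *)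

(** Where a monotone function has a single zero, it is bounded away from zero
    outside every neighbourhood of that zero. *)
Lemma monotone_zero_cvg {R : realType} (H z : R -> R) (x : R) :
  (forall a b, a <= b -> H a <= H b) -> (forall a, H a = 0 <-> a = x) ->
  (z t - x) * H (z t) @[t --> +oo] --> 0 -> z t @[t --> +oo] --> x.
Proof.
move=> Hmono H0 /cvg_tailP zH0; apply/cvg_tailP => e e0.
have Hx : H x = 0 by apply/H0.
have Hr : 0 < H (x + e).
  rewrite lt_neqAle -{2}Hx Hmono ?lerDl ?(ltW e0)// andbT eq_sym.
  by apply/eqP => /H0/eqP; rewrite -subr_eq0 addrAC subrr add0r gt_eqF.
have Hl : H (x - e) < 0.
  rewrite lt_neqAle -{2}Hx Hmono ?gerBl ?(ltW e0)// andbT.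
  by apply/eqP => /H0/eqP; rewrite -subr_eq0 addrAC subrr add0r oppr_eq0 gt_eqF.
pose d := Num.min (H (x + e)) (- H (x - e)).
have d0 : 0 < d by rewrite lt_min Hr oppr_gt0.
have [|A hA] := zH0 (e * d / 2); first by rewrite !mulr_gt0// invr_gt0.
exists A => t /hA; rewrite subr0 => small; rewrite leNgt; apply/negP => ze.
have : e * d <= `|(z t - x) * H (z t)|.
  rewrite normrM ler_pM ?(ltW e0) ?(ltW d0) ?(ltW ze)//.
  move: ze; rewrite ltr_normr => /orP[|] ze.
    by rewrite ge_min ler_normr Hmono//; lra.
  by rewrite ge_min; apply/orP; right; rewrite ler_normr lerN2 Hmono ?orbT//; lra.
move=> /le_trans/(_ small); rewrite leNgt ltr_pdivrMr// ltr_pMr ?mulr_gt0//.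
by rewrite ltr1n.
Qed.

Lemma cvg0D {R : realType} (u v : R -> R) : u t @[t --> +oo] --> 0 ->
  v t @[t --> +oo] --> 0 -> (u + v) t @[t --> +oo] --> 0.
Proof. by move=> u0 v0; have := cvgD u0 v0; rewrite addr0; exact. Qed.

Lemma cvg0_sum {R : realType} (T : finType) (u : T -> R -> R) :
  (forall k, u k t @[t --> +oo] --> 0) -> \sum_k u k t @[t --> +oo] --> 0.
Proof.
move=> u0; rewrite (_ : (fun t => _) = \sum_k u k); last first.
  by apply/funext => t; rewrite fct_sumE.
elim/big_ind: _ => // [|v w v0 w0]; first exact: cvg_cst.
exact: cvg0D.
Qed.

Section Dynamics.
Context {R : realType} {T : finType} (c : T -> T -> R).
Context (c_sym : forall p q, c p q = c q p) (c_ge0 : forall p q, 0 <= c p q)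
  (c_connected : forall p q, connect (fun r s => 0 < c r s) p q).
Context (h : T -> R -> R) (h_lip : T -> R)
  (h_lipschitz : forall k a b, `|h k a - h k b| <= h_lip k * `|a - b|)
  (h_mono : forall k a b, a <= b -> h k a <= h k b).
Context (x : R) (x_unique : forall z, \sum_k h k z = 0 -> z = x).
Context (ls : T -> R) (ls_eq : forall k, laplacian c ls k + h k x = 0).
Context (y l : T -> R -> R).
Context (y_derive : forall (t : R) k, 0 < t -> is_derive t 1 (y k)
    (- h k (y k t) - laplacian c (y^~ t) k - laplacian c (l^~ t) k))
  (l_derive : forall (t : R) k, 0 < t ->
    is_derive t 1 (l k) (laplacian c (y^~ t) k)).

Let mu k t := l k t - ls k.

Let dy k t :=
  - (h k (y k t) - h k x) - laplacian c (y^~ t) k - laplacian c (mu^~ t) k.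

Lemma y_derive_centered (t : R) k : 0 < t -> is_derive t 1 (y k) (dy k t).
Proof.
move=> t0; apply: is_derive_eq (y_derive k t0) _; rewrite /dy laplacianB.
have := ls_eq k; lra.
Qed.

Let lyapunov t := \sum_k ((y k t - x) ^+ 2 + mu k t ^+ 2).

Let dissipation t :=
  \sum_k (h k (y k t) - h k x) * (y k t - x) + energy c (y^~ t).

Lemma monotone_term_ge0 k a b : 0 <= (h k a - h k b) * (a - b).
Proof.
have [ab|/ltW ba] := leP a b.
  by rewrite mulr_le0// subr_le0// h_mono.
by rewrite mulr_ge0// subr_ge0// h_mono.
Qed.

Lemma dissipation_ge0 t : 0 <= dissipation t.
Proof.
by rewrite addr_ge0 ?energy_ge0// sumr_ge0// => k _; exact: monotone_term_ge0.
Qed.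

(** The coupling terms of the two equations cancel, the Laplacian being
    symmetric: only the dissipative terms are left. *)
Lemma lyapunov_derive (t : R) : 0 < t ->
  is_derive t 1 lyapunov (-2 * dissipation t).
Proof.
move=> t0; pose dV k t := 2 * (y k t - x) * dy k t +
  2 * mu k t * laplacian c (y^~ t) k.
have V' : is_derive t 1 lyapunov (\sum_k dV k t).
  apply: is_derive_fin_sum => k.
  have y' := y_derive_centered k t0; have l' := l_derive k t0.
  apply: is_derive_eq; rewrite /dV.
  by rewrite /GRing.scale /=; ring.
apply: is_derive_eq V' _.
have E : \sum_k (y k t - x) * laplacian c (mu^~ t) k =
    \sum_k mu k t * laplacian c (y^~ t) k.
  rewrite (laplacian_sym c_sym (mu^~ t)).
  apply: eq_bigr => k _; congr (_ * _).
  by rewrite laplacianB laplacian_cst subr0.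
have E' : \sum_k (y k t - x) * laplacian c (y^~ t) k = energy c (y^~ t).
  under eq_bigr do rewrite mulrBl.
  by rewrite sumrB -mulr_sumr sum_laplacian// mulr0 subr0.
transitivity (-2 * (\sum_k (h k (y k t) - h k x) * (y k t - x) +
    \sum_k (y k t - x) * laplacian c (y^~ t) k +
    \sum_k (y k t - x) * laplacian c (mu^~ t) k -
    \sum_k mu k t * laplacian c (y^~ t) k)).
  rewrite -!big_split -sumrB mulr_sumr; apply: eq_bigr => k _ /=.
  by rewrite /dV /dy; ring.
by rewrite E E' addrK.
Qed.

Lemma lyapunov_nonincreasing s t : 1 <= s -> s <= t -> lyapunov t <= lyapunov s.
Proof.
move=> s1; rewrite le_eqVlt => /predU1P[->//|st].
have [|r _ E] := @mean_value _ lyapunov (fun r => -2 * dissipation r) s t _ st.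
  by move=> r sr _; apply: lyapunov_derive; lra.
rewrite -subr_le0 E mulr_le0_ge0 ?subr_ge0 ?(ltW st)//.
by have := dissipation_ge0 r; lra.
Qed.

Lemma lyapunov_ge0 t : 0 <= lyapunov t.
Proof. by apply: sumr_ge0 => k _; rewrite addr_ge0 ?sqr_ge0. Qed.

Lemma lyapunov_bound k t : 1 <= t ->
  (y k t - x) ^+ 2 <= lyapunov 1 /\ mu k t ^+ 2 <= lyapunov 1.
Proof.
move=> t1; have := lyapunov_nonincreasing (lexx 1) t1.
rewrite {1}/lyapunov (bigD1 k)//=; set r := \sum_(_ | _) _.
have : 0 <= r by apply: sumr_ge0 => j _; rewrite addr_ge0 ?sqr_ge0.
by have := sqr_ge0 (y k t - x); have := sqr_ge0 (mu k t); lra.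
Qed.

Lemma norm_le_sqr (a : R) : `|a| <= 1 + a ^+ 2.
Proof. by rewrite -real_normK ?num_real//; have := sqr_ge0 `|a|; have := sqr_ge0 (`|a| - 1); lra. Qed.

Lemma y_bounded k : bounded_tail (y k).
Proof.
exists (`|x| + (1 + lyapunov 1)) => t t1.
rewrite -[y k t](subrKC x) (le_trans (ler_normD _ _))// lerD2l.
by rewrite (le_trans (norm_le_sqr _))// lerD2l (lyapunov_bound k t1).1.
Qed.

Lemma mu_bounded k : bounded_tail (mu k).
Proof.
exists (1 + lyapunov 1) => t t1.
by rewrite (le_trans (norm_le_sqr _))// lerD2l (lyapunov_bound k t1).2.
Qed.

Lemma bounded_tail_laplacian (u : T -> R -> R) k : (forall k, bounded_tail (u k)) ->
  bounded_tail (fun t => laplacian c (u^~ t) k).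
Proof.
move=> bu; apply: bounded_tail_sum => q.
apply: bounded_tailM; first exact: bounded_tail_cst.
by apply: bounded_tailB.
Qed.

Lemma tame_laplacian (u : T -> R -> R) k : (forall k, tame (u k)) ->
  tame (fun t => laplacian c (u^~ t) k).
Proof.
move=> bu; apply: tame_sum => q.
by apply: tameM; [exact: tame_cst|exact: tameB].
Qed.

Lemma mu_tame k : tame (mu k).
Proof.
apply: (tame_derive (du := fun t => laplacian c (y^~ t) k)).
- move=> t t1; rewrite -[laplacian _ _ _]subr0.
  have l' : is_derive t 1 (l k) (laplacian c (y^~ t) k) by apply: l_derive; lra.
  exact: is_deriveB.
- exact: mu_bounded.
- exact/bounded_tail_laplacian/y_bounded.
Qed.

Lemma y_tame k : tame (y k).
Proof.
apply: (tame_derive (du := dy k)).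
- by move=> t t1; apply: y_derive_centered; lra.
- exact: y_bounded.
- apply: bounded_tailB; last exact/bounded_tail_laplacian/mu_bounded.
  apply: bounded_tailB; last exact/bounded_tail_laplacian/y_bounded.
  apply: bounded_tailN; apply: bounded_tailB; last exact: bounded_tail_cst.
  exact: bounded_tail_comp (h_lipschitz k) (y_bounded k).
Qed.

Lemma dy_tame k : tame (dy k).
Proof.
apply: tameB; last exact/tame_laplacian/mu_tame.
apply: tameB; last exact/tame_laplacian/y_tame.
apply: tameN; apply: tameB; last exact: tame_cst.
exact: tame_comp (h_lipschitz k) (y_tame k).
Qed.

Lemma dissipation_tame : tame dissipation.
Proof.
apply: tameD; apply: tame_sum => k; last first.
  by apply: tameM; [exact: y_tame|exact/tame_laplacian/y_tame].
apply: tameM; apply: tameB; try exact: tame_cst; last exact: y_tame.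
exact: tame_comp (h_lipschitz k) (y_tame k).
Qed.

Lemma dissipation_cvg0 : dissipation t @[t --> +oo] --> 0.
Proof.
have [] := @nonincreasing_tail_cvg _ lyapunov.
- by move=> t _; exact: lyapunov_ge0.
- exact: lyapunov_nonincreasing.
move=> V Vcvg.
have V'0 : -2 * dissipation t @[t --> +oo] --> 0.
  apply: (barbalat (u := lyapunov)) Vcvg.
    by move=> t t1; apply: lyapunov_derive; lra.
  by have [] := tameM (tame_cst (-2)) dissipation_tame.
apply: (squeeze_tail (C := 2^-1) V'0) => t _.
by rewrite normrM normrN (ger0_norm (ler0n _ 2)) mulKf.
Qed.

Lemma energy_y_cvg0 : energy c (y^~ t) @[t --> +oo] --> 0.
Proof.
apply: (squeeze_tail (C := 1) dissipation_cvg0) => t _.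
rewrite mul1r !ger0_norm ?energy_ge0 ?dissipation_ge0// lerDr.
by apply: sumr_ge0 => k _; exact: monotone_term_ge0.
Qed.

Lemma y_consensus p q : y p t - y q t @[t --> +oo] --> 0.
Proof. exact: energy_cvg0 energy_y_cvg0 p q. Qed.

Lemma h_cvg0 k (u v : R -> R) : u t - v t @[t --> +oo] --> 0 ->
  h k (u t) - h k (v t) @[t --> +oo] --> 0.
Proof. by move=> /squeeze_tail; apply => t _; exact: h_lipschitz. Qed.

(** By consensus all entries may be replaced by the entry at [p] in the
    dissipation, which then says that [(y p t - x) * \sum_k h k (y p t)] tends
    to zero. *)
Lemma y_cvg p : y p t @[t --> +oo] --> x.
Proof.
pose H z := \sum_k h k z.
have Hx : H x = 0.
  have := sum_laplacian c_sym ls.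
  under eq_bigr do rewrite (canRL (addrK _) (ls_eq _)) sub0r.
  by rewrite sumrN => /eqP; rewrite oppr_eq0 => /eqP.
apply: (@monotone_zero_cvg _ H).
- by move=> a b ab; apply: ler_sum => k _; exact: h_mono.
- by move=> a; split=> [/x_unique|->].
have D0 : \sum_k (h k (y k t) - h k x) * (y k t - x) @[t --> +oo] --> 0.
  apply: (squeeze_tail (C := 1) dissipation_cvg0) => t _.
  rewrite mul1r !ger0_norm ?dissipation_ge0 ?lerDl ?energy_ge0//.
  by apply: sumr_ge0 => k _; exact: monotone_term_ge0.
have hb q k : bounded_tail (fun t => h k (y q t) - h k x).
  apply: bounded_tailB; last exact: bounded_tail_cst.
  exact: bounded_tail_comp (h_lipschitz k) (y_bounded q).
have yb q : bounded_tail (fun t => y q t - x).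
  by apply: bounded_tailB; [exact: y_bounded|exact: bounded_tail_cst].
have D1 : \sum_k (h k (y p t) - h k x) * (y p t - y k t) @[t --> +oo] --> 0.
  by apply: cvg0_sum => k; apply: bounded_tail_cvg0M => //; exact: y_consensus.
have D2 : \sum_k (y k t - x) * (h k (y p t) - h k (y k t)) @[t --> +oo] --> 0.
  apply: cvg0_sum => k; apply: bounded_tail_cvg0M => //; apply: h_cvg0.
  exact: y_consensus.
rewrite (_ : (fun t => _) =
    (fun t => \sum_k (h k (y k t) - h k x) * (y k t - x)) +
    (fun t => \sum_k (h k (y p t) - h k x) * (y p t - y k t)) +
    (fun t => \sum_k (y k t - x) * (h k (y p t) - h k (y k t)))); last first.
  apply/funext => t; rewrite !fctE /=.
  have -> : H (y p t) = \sum_k (h k (y p t) - h k x).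
    by rewrite sumrB [X in _ - X]Hx subr0.
  by rewrite mulr_sumr -!big_split; apply: eq_bigr => k _ /=; ring.
by do 2!apply: cvg0D => //.
Qed.

(** Since [y] converges, Barbalat's lemma gives [dy --> 0]; the equation for [y]
    then leaves the Laplacian of [mu] as the only term whose limit is unknown. *)
Lemma laplacian_mu_cvg0 k : laplacian c (mu^~ t) k @[t --> +oo] --> 0.
Proof.
have dy0 : dy k t @[t --> +oo] --> 0.
  apply: barbalat (y_cvg k); last by have [] := dy_tame k.
  by move=> t t1; apply: y_derive_centered; lra.
have h0 : h k (y k t) - h k x @[t --> +oo] --> 0.
  apply: (@h_cvg0 k (y k) (fun=> x)).
  by rewrite -(subrr x); apply: cvgB; [exact: y_cvg|exact: cvg_cst].
have lap0 : laplacian c (y^~ t) k @[t --> +oo] --> 0.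
  apply: cvg0_sum => q; apply: bounded_tail_cvg0M; first exact: bounded_tail_cst.
  exact: y_consensus.
rewrite (_ : (fun t => _) = - (dy k + (fun t => h k (y k t) - h k x) +
  (fun t => laplacian c (y^~ t) k))).
  by rewrite -(oppr0 R); apply: cvgN; do 2!apply: cvg0D => //.
by apply/funext => t; rewrite !fctE /dy; ring.
Qed.

Lemma l_cvg (l_sum : forall t, 0 < t -> \sum_k l k t = \sum_k ls k) p :
  l p t @[t --> +oo] --> ls p.
Proof.
suff mu0 : mu p t @[t --> +oo] --> 0.
  have -> : l p = mu p + cst (ls p) by apply/funext => t; rewrite !fctE subrK.
  by have := cvgD mu0 (cvg_cst (ls p)); rewrite add0r; exact.
have en0 : energy c (mu^~ t) @[t --> +oo] --> 0.
  apply: cvg0_sum => k; apply: bounded_tail_cvg0M; first exact: mu_bounded.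
  exact: laplacian_mu_cvg0.
have dev0 : \sum_q (mu p t - mu q t) @[t --> +oo] --> 0.
  by apply: cvg0_sum => q; exact: energy_cvg0 en0 p q.
have T0 : (0 < #|T|)%N by apply/card_gt0P; exists p.
(* the deviations [mu q t] have zero sum *)
apply: (squeeze_tail (C := 1) dev0) => t t1; rewrite mul1r sumrB.
rewrite [X in _ - X]sumrB l_sum ?subrr; last by lra.
by rewrite subr0 sumr_const normrMn -mulr_natl ler_peMl// ler1n.
Qed.

End Dynamics.

(** * Differentiable convex functions *)

Section Convex.
Context {R : realType} (f : R -> R).
Context (f_convex : convex_function (setT : set R^o) f)
  (f_derivable : forall x : R, derivable f x 1).

(** The slope of [f] between [x] and [x + s * (z - x)], for [s] in [0, 1], is at
    most its slope between [x] and [z]; let [s] tend to zero from the right. *)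
Lemma convex_tangent (x z : R) : derive1 f x * (z - x) <= f z - f x.
Proof.
have dfx : differentiable f x by apply/derivable1_diffP.
have -> : derive1 f x * (z - x) = 'D_(z - x) f x.
  by rewrite deriveE// deriv1E// /GRing.scale /= mulrC.
have fd : derivable f x (z - x) by exact: diff_derivable.
rewrite ['D_(z - x) f x](cvg_at_rightE
  (fun h : R => h^-1 *: ((f \o shift x) (h *: (z - x)) - f x)))//.
apply: limr_le.
  have /cvg_ex[d fd'] := fd; apply/cvg_ex; exists d.
  apply: cvg_trans fd'; apply: cvg_app => A [e e0 Ae]; exists e => // s se s0.
  by apply: Ae => //; exact: lt0r_neq0.
near=> s.
have s0 : 0 < s by near: s; exact: nbhs_right_gt.
have s1 : s <= 1 by near: s; exact: nbhs_right_le.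
have fs : f (s * (z - x) + x) <= s * f z + (1 - s) * f x.
  rewrite (_ : s * _ + x = s * z + (1 - s) * x); last by ring.
  exact: f_convex (Itv01 (ltW s0) s1) z x (in_setT _) (in_setT _).
by rewrite /GRing.scale /= mulrC ler_pdivrMr//; lra.
Unshelve. all: by end_near. Qed.

Lemma convex_derive1_mono (a b : R) : a <= b -> derive1 f a <= derive1 f b.
Proof.
rewrite le_eqVlt => /predU1P[->//|ab].
have := convex_tangent a b; have := convex_tangent b a.
rewrite -[a - b]opprB mulrN -subr_ge0 => h1 h2.
by rewrite -(ler_pM2r (_ : 0 < b - a)) ?subr_gt0//; lra.
Qed.

End Convex.

(** Fermat's rule in one direction; in the other, add up the tangent
    inequalities. *)
Lemma minimizer_sum_convex {R : realType} (T : finType) (F : T -> R -> R)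
    (F_convex : forall k, convex_function (setT : set R^o) (F k))
    (F_derivable : forall k (x : R), derivable (F k) x 1) (x : R) :
  minimizer (fun z => \sum_k F k z) x <-> \sum_k derive1 (F k) x = 0.
Proof.
have F' (z : R) : is_derive z 1 (fun z => \sum_k F k z) (\sum_k derive1 (F k) z).
  apply: (is_derive_fin_sum (du := fun k => derive1 (F k))) => k.
  rewrite derive1E; exact: derivableP.
split=> [xmin|x0 z].
  have xin : x \in `]x - 1, x + 1[%R by rewrite in_itv /=; apply/andP; split; lra.
  have ler : x - 1 <= x + 1 by lra.
  have F0 := derive1_at_min ler (fun t _ => @ex_derive _ _ _ _ _ _ _ (F' t)) xin
    (fun t _ => xmin t).
  by rewrite -(@derive_val _ _ _ _ _ _ _ (F' x)) (@derive_val _ _ _ _ _ _ _ F0).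
have E : \sum_k derive1 (F k) x * (z - x) = 0 by rewrite -mulr_suml x0 mul0r.
rewrite -subr_ge0 -sumrB -[leLHS]E.
by apply: ler_sum => k _; exact: convex_tangent.
Qed.

(** * The supra-Laplacian as a graph Laplacian *)

Section Multiplex.
Context {R : realType} {M N : nat}.
Implicit Types (G : multiplex R M N) (f : 'I_M -> 'I_N -> R -> R).

(** The inverse of [mxvec_index]. *)
Definition node (k : 'I_(M * N)) : 'I_M * 'I_N :=
  enum_val (cast_ord (esym (mxvec_cast M N)) k).

Lemma node_mxvec_index a i : node (mxvec_index a i) = (a, i).
Proof. by rewrite /node /mxvec_index cast_ordK enum_rankK. Qed.

Lemma mxvec_index_node k : mxvec_index (node k).1 (node k).2 = k.
Proof. by case/mxvec_indexP: k => a i; rewrite node_mxvec_index. Qed.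

Lemma sum_node (F : 'I_(M * N) -> R) :
  \sum_k F k = \sum_a \sum_i F (mxvec_index a i).
Proof.
rewrite (reindex _ (curry_mxvec_bij _ _)) /=.
by rewrite pair_bigA; apply: eq_bigr => -[a i].
Qed.

Definition coupling G (p q : 'I_M * 'I_N) : R :=
  if p.1 == q.1 then intradiff G p.1 * weight G p.1 p.2 q.2
  else if p.2 == q.2 then interdiff G p.1 q.1 else 0.

Definition node_coupling G (k l : 'I_(M * N)) : R := coupling G (node k) (node l).

Lemma node_coupling_sym G k l : node_coupling G k l = node_coupling G l k.
Proof.
rewrite /node_coupling /coupling [(node l).1 == _]eq_sym [(node l).2 == _]eq_sym.
by case: eqP => [->|_]; [rewrite weight_sym|rewrite interdiff_sym].
Qed.

Lemma node_coupling_ge0 G k l : 0 <= node_coupling G k l.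
Proof.
rewrite /node_coupling /coupling; case: ifPn => [_|kl].
  by rewrite mulr_ge0 ?weight_ge0// ltW// intradiff_gt0.
by case: ifP => // _; exact: interdiff_ge0.
Qed.

Lemma replica_adj_coupling G p q : replica_adj G p q -> 0 < coupling G p q.
Proof.
rewrite /coupling => /orP[/andP[-> //]|/and3P[-> /negPf -> //]].
Qed.

Lemma node_coupling_connected G : multiplex_connected G ->
  forall k l, connect (fun r s => 0 < node_coupling G r s) k l.
Proof.
move=> Gc k l; have [w + E] := connectP (Gc (node k) (node l)).
rewrite -[l]mxvec_index_node E => {E l}; elim: w k => [k _ /=|p w IH k /=].
  by rewrite mxvec_index_node connect0.
move=> /andP[kp pw].
have Ep : node (mxvec_index p.1 p.2) = p by rewrite node_mxvec_index; case: (p).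
apply: (@connect_trans _ _ (mxvec_index p.1 p.2)).
  by apply: connect1; rewrite /node_coupling Ep; exact: replica_adj_coupling.
by have := IH (mxvec_index p.1 p.2); rewrite Ep; exact.
Qed.

Lemma supra_laplacian_coupling G (u : 'cV[R]_(M * N)) k :
  (supra_laplacian G *m u) k 0 =
  laplacian (node_coupling G) (fun l => u l 0) k.
Proof.
rewrite supra_laplacianE; case/mxvec_indexP: k => a i.
rewrite /supra_diffusion !mxE mxvecE mxE /laplacian sum_node [RHS](bigD1 a)//=.
congr (_ + _).
  rewrite mulr_sumr; apply: eq_bigr => j _.
  by rewrite /node_coupling !node_mxvec_index /coupling eqxx /= mulrA.
apply: eq_bigr => b ba; rewrite (bigD1 i)//= big1 => [|j ji].
  rewrite addr0 /node_coupling !node_mxvec_index /coupling /=.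
  by rewrite eq_sym (negPf ba) eqxx.
rewrite /node_coupling !node_mxvec_index /coupling /=.
by rewrite eq_sym (negPf ba) eq_sym (negPf ji) mul0r.
Qed.

Definition node_cost f (k : 'I_(M * N)) : R -> R := f (node k).1 (node k).2.

Lemma ftilde_node f y : ftilde f y = \sum_k node_cost f k (y k 0).
Proof.
rewrite sum_node; apply: eq_bigr => a _; apply: eq_bigr => i _.
by rewrite /node_cost node_mxvec_index.
Qed.

Lemma common_cost_node f : common_cost f = fun x => \sum_k node_cost f k x.
Proof.
apply/funext => x; rewrite /common_cost sum_node; apply: eq_bigr => a _.
apply: eq_bigr => i _.
by rewrite /node_cost node_mxvec_index.
Qed.

(** The two difference quotients are equal: moving coordinate [k] changes no other
    summand of [ftilde]. *)
Lemma gradient_ftilde f y k :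
  gradient (ftilde f) y k 0 = derive1 (node_cost f k) (y k 0).
Proof.
rewrite mxE derive1E /partial /derive.
rewrite (_ : (fun s => _) = (fun s : R => s^-1 *:
  ((node_cost f k \o shift (y k 0)) (s *: 1) - node_cost f k (y k 0))))//.
apply/funext => s /=; congr (_ * _); rewrite !ftilde_node.
rewrite [in LHS](bigD1 k)//= [X in _ - X](bigD1 k)//= !mxE !eqxx.
rewrite opprD addrACA -sumrB big1 ?addr0// => j jk.
by rewrite !mxE (negPf jk) mulr0 add0r subrr.
Qed.

End Multiplex.

(** * Coordinates of vector-valued trajectories *)

Section Coordinates.
Context {R : realType} {n : nat}.
Implicit Types (y : R -> 'cV[R]_n) (u v : 'cV[R]_n).

Lemma is_derive_coord y v (t : R) k :
  is_derive t 1 y v -> is_derive t 1 (fun s => y s k 0) (v k 0).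
Proof.
move=> [dy yv]; apply: DeriveDef; first exact: (derivable_mxP _ _ _).1 dy k 0.
by rewrite -yv derive_mx// mxE.
Qed.

Lemma cvg_coord y v :
  (forall k, y t k 0 @[t --> +oo] --> v k 0) -> y t @[t --> +oo] --> v.
Proof.
move=> yv; apply/cvgrPdist_le => e e0; near=> t.
rewrite [leLHS]/Num.Def.normr/= mx_normrE (bigmax_le _ (ltW e0))//= => -[k j] _.
rewrite !mxE /= ord1; move: k; near: t; apply: filter_forall => k.
exact: ((cvgrPdist_le _ _).1 (yv k)).
Unshelve. all: by end_near. Qed.

Lemma continuous_sum_coord : continuous (fun u => \sum_k u k 0).
Proof.
move=> u; rewrite (_ : (fun u => _) = \sum_k (fun u : 'cV[R]_n => u k 0)).
  elim/big_ind: _ => [|f g cf cg|k _]; first exact: (@cst_continuous _ _ 0).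
    exact: continuousD.
  exact: coord_continuous.
by apply/funext => w; rewrite fct_sumE.
Qed.

Lemma dotE u v : dot u v = \sum_k u k 0 * v k 0.
Proof. by rewrite /dot mxE; apply: eq_bigr => k _; rewrite mxE. Qed.

End Coordinates.

(** Continuity at 0 is what ties the conserved sum of the multipliers to its
    initial value. *)
Lemma derive0_constant {R : realType} (u : R -> R) :
  {within `[0, +oo[, continuous u} ->
  (forall t : R, 0 < t -> is_derive t 1 u 0) -> forall t : R, 0 < t -> u t = u 0.
Proof.
move=> uc u0 t t0; have [||c _] := @MVT R u (fun=> 0) 0 t t0.
- by move=> s; rewrite in_itv /= => /andP[s0 _]; exact: u0.
- by apply: continuous_subspaceW uc; exact: subset_itvl.
by rewrite mul0r => /eqP; rewrite subr_eq0 => /eqP.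
Qed.

(** * Convergence of the multiplex dynamics *)

Theorem theorem1 (R : realType) (M N : nat) (G : multiplex R M N)
    (f : 'I_M -> 'I_N -> R -> R)
    (G_connected : multiplex_connected G)
    (f_convex : forall a i, convex_function (setT : set R^o) (f a i))
    (f_differentiable : forall a i (x : R), derivable (f a i) x 1)
    (f_lipschitz : forall a i, lipschitz (derive1 (f a i)))
    (unique_optimum : exists! x : R, minimizer (common_cost f) x)
    (ftilde_C2 : twice_continuously_differentiable (@ftilde R M N f))
    (ftilde_convex :
       convex_function (setT : set 'cV[R]_(M * N)) (@ftilde R M N f))
    (y0 l0 : 'cV[R]_(M * N)) :
  exists ys ls : 'cV[R]_(M * N),
    [/\ saddle_point (augmented_lagrangian G f) ys ls,
        limit_conditions G f l0 ys ls,
        forall ys' ls' : 'cV[R]_(M * N),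
          limit_conditions G f l0 ys' ls' -> ys' = ys /\ ls' = ls
      & forall y l : R -> 'cV[R]_(M * N),
          saddle_point_trajectory G f y0 l0 y l ->
          (y t @[t --> +oo] --> ys) /\ (l t @[t --> +oo] --> ls)].
Proof.
pose c := node_coupling G; pose F := node_cost f.
pose h k := derive1 (F k).
have c_sym : forall k l, c k l = c l k by exact: node_coupling_sym.
have c_ge0 : forall k l, 0 <= c k l by exact: node_coupling_ge0.
have c_conn := node_coupling_connected G_connected.
have F_convex k : convex_function (setT : set R^o) (F k) by exact: f_convex.
have F_der k (x : R) : derivable (F k) x 1 by exact: f_differentiable.
have h_mono k a b : a <= b -> h k a <= h k b by exact: convex_derive1_mono.
have /choice[h_lip h_lipP] : forall k, exists K : R,
    forall a b, `|h k a - h k b| <= K * `|a - b|.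
  move=> k; have [K [_ hK]] := f_lipschitz (node k).1 (node k).2.
  exists (K + 1) => a b; apply: (hK (K + 1) _ (a, b)) => //.
  by rewrite ltrDl.
have minP x : minimizer (common_cost f) x <-> \sum_k h k x = 0.
  by rewrite common_cost_node; exact: minimizer_sum_convex.
have [x [/[dup] xmin /minP hx x_uniq]] := unique_optimum.
have [lb lb_sum lb_eq] : exists2 u, \sum_k u k = 0 &
    forall k, laplacian c u k = - h k x.
  by apply: (laplacian_solve c_sym c_ge0 c_conn); rewrite sumrN hx oppr0.
have n_neq0 : (M * N)%:R != 0 :> R.
  (* without nodes every point would be an optimizer *)
  rewrite pnatr_eq0; apply/eqP => n0.
  have min_all z : minimizer (common_cost f) z.
    by apply/minP; rewrite big1// => k _; have := ltn_ord k; rewrite {2}n0.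
  have := x_uniq _ (min_all 0); rewrite (x_uniq _ (min_all 1)) => /eqP.
  by rewrite oner_eq0.
have sum_avg (u : 'cV[R]_(M * N)) :
    \sum_(k < M * N) average u = \sum_k u k 0.
  by rewrite sumr_const card_ord -mulr_natr /average divfK.
pose ys : 'cV[R]_(M * N) := x *: const_mx 1.
pose lbar : 'cV[R]_(M * N) := \col_k lb k.
pose ls : 'cV[R]_(M * N) := lbar + average l0 *: const_mx 1.
have ysE k : ys k 0 = x by rewrite !mxE mulr1.
have lsE k : ls k 0 = lb k + average l0 by rewrite !mxE mulr1.
have Lys : supra_laplacian G *m ys = 0.
  apply/colP => k; rewrite supra_laplacian_coupling mxE.
  by rewrite /laplacian big1// => l _; rewrite !ysE subrr mulr0.
have grad_ys k : gradient (ftilde f) ys k 0 = h k x.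
  by rewrite gradient_ftilde ysE.
have Lls k : laplacian c (fun k => ls k 0) k = - h k x.
  rewrite -lb_eq; apply: eq_bigr => q _; rewrite !lsE; congr (_ * _); ring.
have dot_lap (u v : 'cV[R]_(M * N)) : dot u (supra_laplacian G *m v) =
    \sum_k u k 0 * laplacian c (fun k => v k 0) k.
  by rewrite dotE; apply: eq_bigr => k _; rewrite supra_laplacian_coupling.
have lim_ys_ls : limit_conditions G f l0 ys ls.
  split; first by exists x.
  exists lbar; split => //.
    by rewrite dotE -[RHS]lb_sum; apply: eq_bigr => k _; rewrite !mxE mulr1.
  apply/colP => k; rewrite mxE supra_laplacian_coupling grad_ys mxE.
  rewrite (_ : laplacian _ _ _ = - h k x) ?addNr// -lb_eq.
  by apply: eq_bigr => q _; rewrite !mxE.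
exists ys, ls; split => //.
- move=> y l; rewrite /augmented_lagrangian Lys.
  have dot0 u : dot u 0 = 0 by rewrite dotE big1// => k _; rewrite mxE mulr0.
  rewrite !dot0 mulr0 !addr0; split => //.
  have := energy_ge0 c_sym c_ge0 (fun k => y k 0).
  rewrite /energy -dot_lap => en.
  have : dot ls (supra_laplacian G *m y) = \sum_k - (h k x * (y k 0 - x)).
    rewrite dot_lap (laplacian_sym c_sym).
    under eq_bigr do rewrite Lls mulrN mulrC.
    under [RHS]eq_bigr do rewrite mulrBr opprB addrC.
    by rewrite big_split /= -mulr_suml hx mul0r addr0.
  have : \sum_k h k x * (y k 0 - x) <= ftilde f y - ftilde f ys.
    rewrite !ftilde_node -sumrB; apply: ler_sum => k _.
    by rewrite ysE; exact: convex_tangent.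
  rewrite sumrN; lra.
- move=> ys' ls' [[x' x'min ->] [lb' [lb'0 lb'eq ->]]].
  have <- : x = x' by exact: x_uniq.
  split=> //; rewrite /ls; congr (_ + _).
  have lb'lap k : laplacian c (fun k => lb' k 0) k = - h k x.
    have := congr1 (fun v : 'cV_(M * N) => v k 0) lb'eq.
    rewrite mxE supra_laplacian_coupling [RHS]mxE.
    have -> : x' = x by symmetry; exact: x_uniq.
    by rewrite grad_ys => /eqP; rewrite addr_eq0 => /eqP.
  have diff_cst : forall p q, lb' p 0 - lb p = lb' q 0 - lb q.
    apply: (laplacian_eq0 c_sym c_ge0 c_conn (u := fun p => lb' p 0 - lb p)).
    by move=> p; rewrite laplacianB lb'lap lb_eq subrr.
  apply/colP => p; rewrite mxE; apply/eqP; rewrite -subr_eq0.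
  have : (M * N)%:R * (lb' p 0 - lb p) = 0.
    rewrite -[RHS](subrr (0 : R)) -{1}lb'0 -lb_sum dotE -sumrB.
    under eq_bigr do rewrite mxE mulr1 (diff_cst _ p).
    by rewrite sumr_const card_ord mulr_natl.
  by move/eqP; rewrite mulf_eq0 (negPf n_neq0).
- move=> y l [[_ l00] yc lc y' l'].
  have yk' (t : R) k : 0 < t -> is_derive t 1 (fun t => y t k 0)
      (- h k (y t k 0) - laplacian c (fun q => y t q 0) k -
       laplacian c (fun q => l t q 0) k).
    move=> t0; have := is_derive_coord k (y' t t0).
    have subE (u v : 'cV[R]_(M * N)) : (u - v) k 0 = u k 0 - v k 0.
      by rewrite !mxE.
    have oppE (u : 'cV[R]_(M * N)) : (- u) k 0 = - u k 0 by rewrite mxE.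
    by rewrite !subE oppE !supra_laplacian_coupling gradient_ftilde.
  have lk' (t : R) k : 0 < t -> is_derive t 1 (fun t => l t k 0)
      (laplacian c (fun q => y t q 0) k).
    move=> t0; have := is_derive_coord k (l' t t0).
    by rewrite supra_laplacian_coupling.
  have ls_eq k : laplacian c (fun k => ls k 0) k + h k x = 0.
    by rewrite Lls addNr.
  have x_zero z : \sum_k h k z = 0 -> z = x by move=> /minP/x_uniq.
  have l_sum (t : R) : 0 < t -> \sum_k l t k 0 = \sum_k ls k 0.
    move=> t0; transitivity (\sum_k l 0 k 0); last first.
      rewrite l00 -sum_avg; under [RHS]eq_bigr do rewrite lsE.
      by rewrite big_split /= lb_sum add0r.
    apply: (derive0_constant (u := fun t => \sum_k l t k 0)) t0.
      apply: (@within_continuous_comp _ _ _ _ l (fun u => \sum_k u k 0)) => // u _.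
      exact: continuous_sum_coord.
    move=> s s0.
    apply: is_derive_eq (sum_laplacian c_sym (fun q => y s q 0)).
    by apply: (is_derive_fin_sum (u := fun k t => l t k 0)
      (du := fun k t => laplacian c (fun q => y t q 0) k)) => k; exact: lk'.
  split; apply: cvg_coord => k.
    rewrite ysE; exact: (y_cvg c_sym c_ge0 c_conn h_lipP h_mono x_zero ls_eq
      (y := fun k t => y t k 0) (l := fun k t => l t k 0)).
  exact: (l_cvg c_sym c_ge0 c_conn h_lipP h_mono x_zero ls_eq
      (y := fun k t => y t k 0) (l := fun k t => l t k 0)).
Qed.
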